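(* Let $q\in(0,1)$. Then $$P_n^q(S_n(312))=P_n^q(S_n(231))>P_n^q(S_n(213))=P_n^q(S_n(132))\quad\text{for all } n\ge3.$$
   Context: $S_n$ is the set of permutations $\sigma=\sigma_1\cdots\sigma_n$ of $[n]=\{1,\dots,n\}$, where $\sigma_i=\sigma(i)$. For $\tau\in S_m$ with $2\le m\le n$, $\sigma\in S_n$ contains $\tau$ as a pattern if there are indices $1\le i_1<\cdots<i_m\le n$ such that for all $1\le j,k\le m$, $\sigma_{i_j}<\sigma_{i_k}$ if and only if $\tau_j<\tau_k$; otherwise $\sigma$ avoids $\tau$. $S_n(\tau)$ is the set of $\sigma\in S_n$ avoiding $\tau$. For $q>0$, the Mallows distribution with parameter $q$ is the probability measure on $S_n$ given by $P_n^q(\sigma)=q^{\mathrm{inv}(\sigma)}/Z_n(q)$, where $\mathrm{inv}(\sigma)$ is the number of inversions of $\sigma$, i.e. pairs $i<j$ with $\sigma_i>\sigma_j$, and $Z_n(q)=\sum_{\sigma\in S_n}q^{\mathrm{inv}(\sigma)}$, which for $q\neq 1$ equals $\prod_{k=1}^n\frac{1-q^k}{1-q}$. *)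

(* Defs.v *)
From mathcomp Require Import all_boot all_order all_algebra all_fingroup.

Set Implicit Arguments.
Unset Strict Implicit.
Unset Printing Implicit Defensive.

Import Order.TTheory GRing.Theory Num.Theory.

(* Permutations of [n] are elements of 'S_n, acting on 'I_n = {0, ..., n-1}:
   positions and values are both shifted down by one. *)

Definition inv_set n (s : 'S_n) : {set 'I_n * 'I_n} :=
  [set p : 'I_n * 'I_n | (p.1 < p.2) && (s p.2 < s p.1)].

Definition inv n (s : 'S_n) : nat := #|inv_set s|.

Definition contains m n (t : 'S_m) (s : 'S_n) : bool :=
  [exists i : {ffun 'I_m -> 'I_n},
     [forall j : 'I_m, forall k : 'I_m, (j < k) ==> (i j < i k)] &&
     [forall j : 'I_m, forall k : 'I_m, (s (i j) < s (i k)) == (t j < t k)]].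

Definition avoiders m n (t : 'S_m) : {set 'S_n} :=
  [set s : 'S_n | ~~ contains t s].

Definition of_oneline n (w : n.-tuple 'I_n) (w_uniq : uniq w) : 'S_n :=
  perm (elimT (tuple_uniqP w) w_uniq).

Local Notation "''o1'" := (@Ordinal 3 0 isT).
Local Notation "''o2'" := (@Ordinal 3 1 isT).
Local Notation "''o3'" := (@Ordinal 3 2 isT).

Definition pat312 : 'S_3 := @of_oneline 3 [tuple 'o3; 'o1; 'o2] isT.
Definition pat231 : 'S_3 := @of_oneline 3 [tuple 'o2; 'o3; 'o1] isT.
Definition pat213 : 'S_3 := @of_oneline 3 [tuple 'o2; 'o1; 'o3] isT.
Definition pat132 : 'S_3 := @of_oneline 3 [tuple 'o1; 'o3; 'o2] isT.

Definition oneline n (s : 'S_n) : seq nat := [seq (s i).+1 | i <- enum 'I_n].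

Lemma oneline_of n (w : n.-tuple 'I_n) (w_uniq : uniq w) :
  oneline (of_oneline w_uniq) = [seq (val x).+1 | x <- w].
Proof.
have -> : tval w = [seq tnth w i | i <- enum 'I_n] by rewrite map_tnth_enum.
by rewrite -map_comp; apply: eq_map => i /=; rewrite permE.
Qed.

Lemma oneline312 : oneline pat312 = [:: 3; 1; 2].
Proof. exact: oneline_of. Qed.
Lemma oneline231 : oneline pat231 = [:: 2; 3; 1].
Proof. exact: oneline_of. Qed.
Lemma oneline213 : oneline pat213 = [:: 2; 1; 3].
Proof. exact: oneline_of. Qed.
Lemma oneline132 : oneline pat132 = [:: 1; 3; 2].
Proof. exact: oneline_of. Qed.

Local Open Scope ring_scope.

Definition mallows_Z (R : realFieldType) (n : nat) (q : R) : R :=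
  \sum_(s : 'S_n) q ^+ inv s.

Definition mallows (R : realFieldType) (n : nat) (q : R) (s : 'S_n) : R :=
  q ^+ inv s / mallows_Z n q.

Definition mallowsP (R : realFieldType) (n : nat) (q : R) (A : {set 'S_n}) : R :=
  \sum_(s in A) mallows q s.

Lemma mallows_Z_gt0 (R : realFieldType) (n : nat) (q : R) :
  0 < q -> 0 < mallows_Z n q.
Proof.
move=> q0; rewrite /mallows_Z (bigD1 (1%g : 'S_n)) //=.
by apply: ltr_pwDl; rewrite ?exprn_gt0 // sumr_ge0 // => s _; rewrite exprn_ge0 ?ltW.
Qed.

Lemma mallows_ge0 (R : realFieldType) (n : nat) (q : R) (s : 'S_n) :
  0 < q -> 0 <= mallows q s.
Proof. by move=> q0; rewrite divr_ge0 ?exprn_ge0 ?ltW ?mallows_Z_gt0. Qed.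

Lemma mallowsPT (R : realFieldType) (n : nat) (q : R) :
  0 < q -> mallowsP q [set: 'S_n] = 1.
Proof.
move=> q0; rewrite /mallowsP -mulr_suml.
rewrite (eq_bigl xpredT) => [|s]; last by rewrite inE.
by rewrite -/(mallows_Z n q) divff // gt_eqF ?mallows_Z_gt0.
Qed.

(* Main.v *)
(** Group inverse and reverse-complement preserve the number of inversions; the
    first exchanges 312 with 231 and the second exchanges 213 with 132, which
    gives both equalities.  For the inequality, send [s] to the permutation [f s]
    whose inversions are the pairs i < j such that s i is the maximum of s on
    {i, ..., j}: it is the least permutation, for inclusion of inversion sets,
    with the same decreasing binary tree as [s].  It always avoids 231.  When [s]
    avoids 132 and i < j, one has s i < s j iff s j is the maximum of s on
    {i, ..., j}, iff no (k, j) with i <= k < j is an inversion of [f s]; so [f]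
    is injective on the 132-avoiders.  Since inv (f s) <= inv s, strictly for
    s = 2 3 ... n 1, the inequality follows from q < 1. *)

Require Import Defs.
From mathcomp Require Import all_boot all_order all_algebra all_fingroup.
From mathcomp Require Import zify.

Set Implicit Arguments.
Unset Strict Implicit.

Import Order.TTheory GRing.Theory Num.Theory.
Local Open Scope ring_scope.

(* [all_fingroup] shadows [Defs.inv] by the group inverse. *)
Local Notation inv := Defs.inv.

(** * Pattern containment and the group inverse *)

Section Patterns.
Context {m n : nat}.

Lemma containsP (t : 'S_m) (s : 'S_n) :
  reflect (exists i : 'I_m -> 'I_n,
             (forall j k : 'I_m, (j < k)%N -> (i j < i k)%N) /\
             (forall j k : 'I_m, (s (i j) < s (i k))%N = (t j < t k)%N))
          (contains t s).
Proof.
apply: (iffP existsP) => [[i /andP[/forallP hi /forallP hs]] | [i [hi hs]]].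
  exists i; split=> j k; first by apply/implyP; move/forallP: (hi j) => /(_ k).
  by move/forallP: (hs j) => /(_ k)/eqP.
exists [ffun j => i j]; apply/andP; split; apply/forallP => j; apply/forallP => k.
  by rewrite !ffunE; apply/implyP/hi.
by rewrite !ffunE hs.
Qed.

Lemma contains_inv (t : 'S_m) (s : 'S_n) :
  contains t s -> contains t^-1%g s^-1%g.
Proof.
move=> /containsP[i [hi hs]]; apply/containsP.
(* The occurrence of [t^-1] sits at the values of the given occurrence, listed in increasing
   order. *)
exists (fun j => s (i (t^-1%g j))); split=> j k.
  by rewrite hs !permKV.
rewrite !permK; case: (ltngtP (t^-1%g j) (t^-1%g k)) => [|/hi|/val_inj->].
- exact: hi.
- by move=> h; rewrite ltnNge (ltnW h).
- by rewrite ltnn.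
Qed.

End Patterns.

(** * Reverse-complement, and the inversion number under both symmetries *)

Definition rev_perm n : 'S_n := perm (@rev_ord_inj n).

Definition rev_compl n (s : 'S_n) : 'S_n := (rev_perm n * s * rev_perm n)%g.

Lemma rev_complE n (s : 'S_n) i : rev_compl s i = rev_ord (s (rev_ord i)).
Proof. by rewrite !permM !permE. Qed.

Lemma rev_complK n : involutive (@rev_compl n).
Proof. by move=> s; apply/permP => i; rewrite !rev_complE !rev_ordK. Qed.

Lemma ltn_rev_ord n (i j : 'I_n) : (rev_ord i < rev_ord j)%N = (j < i)%N.
Proof. by case: i j => [i hi] [j hj] /=; lia. Qed.

Lemma contains_rev_compl m n (t : 'S_m) (s : 'S_n) :
  contains t s -> contains (rev_compl t) (rev_compl s).
Proof.
move=> /containsP[i [hi hs]]; apply/containsP.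
exists (fun j => rev_ord (i (rev_ord j))); split=> j k.
  by rewrite ltn_rev_ord => jk; apply: hi; rewrite ltn_rev_ord.
by rewrite !rev_complE !ltn_rev_ord !rev_ordK hs.
Qed.

(** Serves both symmetries: each is an involution, so the inequality, used for a permutation and for
    its image, yields equality. *)
Lemma inv_le_inj n (s t : 'S_n) (f : 'I_n * 'I_n -> 'I_n * 'I_n) :
  injective f -> {in inv_set s, forall p, f p \in inv_set t} ->
  (inv s <= inv t)%N.
Proof.
move=> f_inj fst; rewrite /inv -(card_imset _ f_inj) subset_leq_card //.
by apply/subsetP => _ /imsetP[p /fst ? ->].
Qed.

Lemma inv_permV n (s : 'S_n) : inv s^-1%g = inv s.
Proof.
suff le (t : 'S_n) : (inv t <= inv t^-1%g)%N.
  by apply/eqP; rewrite eqn_leq le -{2}(invgK s) le.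
apply: (@inv_le_inj _ _ _ (fun p => (t p.2, t p.1))) => [[a b] [c d]|p].
  by case=> /perm_inj-> /perm_inj->.
by rewrite !inE /= !permK andbC.
Qed.

Lemma inv_rev_compl n (s : 'S_n) : inv (rev_compl s) = inv s.
Proof.
suff le (t : 'S_n) : (inv t <= inv (rev_compl t))%N.
  by apply/eqP; rewrite eqn_leq le -{2}(rev_complK s) le.
apply: (@inv_le_inj _ _ _ (fun p => (rev_ord p.2, rev_ord p.1))) => [[a b] [c d]|p].
  by move=> /pair_equal_spec[/= /rev_ord_inj-> /rev_ord_inj->].
by rewrite !inE /= !rev_complE !rev_ordK !ltn_rev_ord.
Qed.

Lemma perm_ltn_leq n (s : 'S_n) i j : i != j -> (s i < s j)%N = (s i <= s j)%N.
Proof. by rewrite ltn_neqAle -(inj_eq (@perm_inj _ s)) -val_eqE => ->. Qed.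

Lemma perm_ltnN n (s : 'S_n) i j : i != j -> (s j < s i)%N = ~~ (s i < s j)%N.
Proof. by rewrite eq_sym => /perm_ltn_leq ->; rewrite leqNgt. Qed.

Lemma ltn_neq n (i j : 'I_n) : (i < j)%N -> i != j.
Proof. by move=> ij; rewrite -val_eqE neq_ltn ij. Qed.

(** * Patterns of length three *)

Lemma ord3P (P : 'I_3 -> Prop) :
  P (@Ordinal 3 0 isT) -> P (@Ordinal 3 1 isT) -> P (@Ordinal 3 2 isT) ->
  forall i, P i.
Proof. by move=> ? ? ? [[|[|[|//]]] h]; rewrite (bool_irrelevance h isT). Qed.

Lemma invg_pat312 : (pat312^-1 = pat231)%g.
Proof.
apply: (mulgI pat312); rewrite mulgV; apply/permP; apply: ord3P;
  by rewrite permM !permE /= ?permE; apply/val_inj.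
Qed.

Lemma rev_compl_pat213 : rev_compl pat213 = pat132.
Proof.
apply/permP; apply: ord3P; rewrite rev_complE !permE /=; exact/val_inj.
Qed.

(** Comparing the three increasing pairs of positions is enough: injectivity settles the reversed
    pairs. *)
Lemma contains3P n (t : 'S_3) (s : 'S_n) :
  let o1 := @Ordinal 3 0 isT in
  let o2 := @Ordinal 3 1 isT in
  let o3 := @Ordinal 3 2 isT in
  reflect (exists i j k : 'I_n, [/\ (i < j < k)%N,
             (s i < s j)%N = (t o1 < t o2)%N, (s i < s k)%N = (t o1 < t o3)%N &
             (s j < s k)%N = (t o2 < t o3)%N])
          (contains t s).
Proof.
move=> o1 o2 o3.
apply: (iffP (containsP _ _)) => [[i [hi hs]]|[i [j [k [/andP[ij jk] h1 h2 h3]]]]].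
  by exists (i o1), (i o2), (i o3); rewrite !hs; split=> //; rewrite !hi.
have [ij' ik' jk'] : [/\ i != j, i != k & j != k].
  by split; apply: ltn_neq => //; exact: ltn_trans jk.
exists (tnth [tuple i; j; k]); split; apply: ord3P; apply: ord3P => //=;
  rewrite !(tnth_nth i) //= ?ltnn ?(ltn_trans ij) //.
- by rewrite perm_ltnN // h1 -perm_ltnN.
- by rewrite perm_ltnN // h2 -perm_ltnN.
- by rewrite perm_ltnN // h3 -perm_ltnN.
Qed.

Lemma contains132P n (s : 'S_n) :
  reflect (exists i j k : 'I_n, (i < j < k)%N /\ (s i < s k < s j)%N)
          (contains pat132 s).
Proof.
apply: (iffP (contains3P _ _)) => [] [i [j [k]]]; rewrite !permE /=.
  case=> /andP[ij jk] _ sik sjk; exists i, j, k.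
  by rewrite ij jk sik perm_ltnN ?sjk ?ltn_neq.
case=> ijk /andP[ik kj]; exists i, j, k; split=> //; rewrite ?permE /=; lia.
Qed.

Lemma contains231 n (s : 'S_n) : contains pat231 s ->
  exists i j k : 'I_n, [/\ (i < j < k)%N, (s i < s j)%N & (s k < s i)%N].
Proof.
move=> /contains3P[i [j [k]]]; rewrite !permE /= => -[ijk ij ik jk].
exists i, j, k; split=> //; rewrite perm_ltnN ?ik // ltn_neq //; lia.
Qed.

Lemma perm_of_total_order n (r : rel 'I_n) :
  irreflexive r -> transitive r -> (forall i j, i != j -> r i j || r j i) ->
  exists s : 'S_n, forall i j, (s i < s j)%N = r i j.
Proof.
move=> rI rT rC.
(* The value given to [i] is its rank, the number of elements below it for [r]. *)
pose d i := #|[set k | r k i]|.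
have d_mono i j : r i j -> (d i < d j)%N.
  move=> rij; apply: proper_card; apply/properP; split.
    by apply/subsetP => k; rewrite !inE => /rT; apply.
  by exists i; rewrite !inE ?rI.
have d_lt i : (d i < n)%N.
  rewrite -[X in (_ < X)%N]card_ord -cardsT; apply: proper_card; apply/properP.
  by split; [exact: subsetT | exists i; rewrite !inE ?rI].
have d_inj : injective (fun i => Ordinal (d_lt i)).
  move=> i j /(congr1 val) /= dij; apply/eqP/negPn/negP => /rC/orP[] /d_mono;
  by rewrite dij ltnn.
exists (perm d_inj) => i j; rewrite !permE /=.
apply/idP/idP => [dij|]; last exact: d_mono.
have [eij|/rC/orP[//|/d_mono]] := eqVneq i j; first by move: dij; rewrite eij ltnn.
by move=> /ltnW; rewrite leqNgt dij.
Qed.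

(** * The map from 132-avoiders to 231-avoiders *)

Section LeftMaxima.
Context {n : nat}.
Implicit Types (s t : 'S_n) (i j k : 'I_n).

(** Equivalently, [j] lies in the right subtree of [i] in the decreasing binary tree of [s]. *)
Definition leftmax s i j := (i < j)%N && [forall k : 'I_n, (i < k <= j)%N ==> (s k < s i)%N].

Lemma leftmaxP s i j :
  reflect ((i < j)%N /\ forall k, (i < k <= j)%N -> (s k < s i)%N) (leftmax s i j).
Proof.
apply: (iffP andP) => -[ij h]; split=> //.
  by move=> k; apply/implyP/(forallP h).
by apply/forallP => k; apply/implyP/h.
Qed.

(** A set of pairs i < j is an inversion set when it and its complement are both transitive. For
    [leftmax s], the former is [lm_trans]; the latter follows from [lm_sub]. The relation [r] is the
    resulting order on values. *)
Lemma exists_leftmax_perm s :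
  exists t, inv_set t == [set p | leftmax s p.1 p.2].
Proof.
pose r i j := if (i < j)%N then ~~ leftmax s i j else (j < i)%N && leftmax s j i.
have lm_trans i j k : leftmax s i j -> leftmax s j k -> leftmax s i k.
  move=> /leftmaxP[ij hi] /leftmaxP[jk hj]; apply/leftmaxP; split; first lia.
  move=> l /andP[il lk]; have [lj|jl] := leqP l j; first by apply: hi; rewrite il.
  by apply: (ltn_trans (hj l _)); [rewrite jl | apply: hi; lia].
have lm_sub i j k : (i < j < k)%N -> leftmax s i k -> leftmax s i j.
  move=> ijk /leftmaxP[ik hi]; apply/leftmaxP; split; first lia.
  by move=> l il; apply: hi; lia.
have rI : irreflexive r by move=> i; rewrite /r ltnn.
have rC i j : i != j -> r i j || r j i.
  by rewrite -val_eqE /r; case: ltngtP => //= _ _; case: leftmax.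
have rT : transitive r.
  move=> j i k; rewrite /r.
  case: (ltngtP i j) => [ij|ij|/val_inj ->];
  case: (ltngtP j k) => [jk|jk|/val_inj <-] //=; rewrite ?ltnn //=.
  - rewrite (ltn_trans ij jk) => nij _.
    by apply: contra nij; apply: lm_sub; rewrite ij.
  - case: (ltngtP i k) => [ik|ik|/val_inj eik] /= nij kj.
    + by apply: contra nij => ik'; exact: lm_trans ik' kj.
    + by apply: lm_sub kj; rewrite ik.
    + by rewrite eik kj in nij.
  - case: (ltngtP i k) => [ik|ik|/val_inj eik] /= ji njk.
    + by apply: contra njk => ik'; exact: lm_trans ji ik'.
    + by move: njk; rewrite (lm_sub j k i) // jk.
    + by move: njk; rewrite -eik ji.
  - have ki := ltn_trans jk ij; rewrite ltnNge (ltnW ki) /= ki => ji kj.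
    exact: lm_trans kj ji.
have [t ht] := perm_of_total_order rI rT rC.
exists t; apply/eqP/setP => -[i j]; rewrite !inE /= ht /r.
case: ltngtP => //= ij; rewrite /leftmax ?ij //.
  by rewrite ltnNge (ltnW ij).
by rewrite ltnn.
Qed.

(** The choice is canonical, since a permutation is determined by its inversion set
    ([inv_set_inj]). *)
Definition leftmax_perm s : 'S_n := xchoose (exists_leftmax_perm s).

Lemma inv_set_leftmax s : inv_set (leftmax_perm s) = [set p | leftmax s p.1 p.2].
Proof. exact: eqP (xchooseP (exists_leftmax_perm s)). Qed.

Lemma inv_setE s i j : (i < j)%N -> (s j < s i)%N = ((i, j) \in inv_set s).
Proof. by rewrite inE /= => ->. Qed.

(** In an occurrence i < j < k of 231, the inversion (i, k) makes s i the maximum of s on {i, ...,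
    k}, hence on {i, ..., j}; then (i, j) is an inversion as well, a contradiction. *)
Lemma leftmax_perm_avoids s : leftmax_perm s \in avoiders n pat231.
Proof.
rewrite inE; apply/negP => /contains231[i [j [k [/andP[ij jk] sij]]]].
rewrite inv_setE ?(ltn_trans ij) // inv_set_leftmax inE => /leftmaxP[_ hik].
have : leftmax s i j.
  by apply/leftmaxP; split=> // l /andP[il lj]; apply: hik; rewrite il ltnW ?(leq_ltn_trans lj).
by move=> lij; have := inv_setE (leftmax_perm s) ij;
  rewrite inv_set_leftmax inE lij ltnNge (ltnW sij).
Qed.

Lemma inv_set_leftmax_sub s : inv_set (leftmax_perm s) \subset inv_set s.
Proof.
rewrite inv_set_leftmax; apply/subsetP => -[i j]; rewrite !inE /= => /leftmaxP[ij h].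
by rewrite ij h ?ij /=.
Qed.

Lemma inv_set_inj : injective (@inv_set n).
Proof.
move=> s t est.
have lt_st i j : (s i < s j)%N = (t i < t j)%N.
  have inv_st (a b : 'I_n) : (a < b)%N -> (s b < s a)%N = (t b < t a)%N.
    by move=> ab; rewrite !inv_setE ?est.
  case: (ltngtP i j) => [ij|/inv_st//|/val_inj->]; last by rewrite !ltnn.
  by rewrite !(@perm_ltnN _ _ j) ?inv_st // eq_sym ltn_neq.
(* Values are ranks, so the comparisons [lt_st] determine the permutation. *)
have val_card (u : 'S_n) i : u i = #|[set k | (u k < u i)%N]| :> nat.
  rewrite -(card_imset _ (@perm_inj _ u)).
  have -> : [set u k | k in [set k | (u k < u i)%N]] = [set l : 'I_n | (l < u i)%N].
    apply/setP => l; rewrite inE; apply/imsetP/idP => [[k]|lt].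
      by rewrite inE => ? ->.
    by exists (u^-1%g l); rewrite ?inE permKV.
  rewrite cardsE -sum1_card.
  by rewrite (big_ord_narrow (ltnW (ltn_ord (u i)))) sum1_card card_ord.
apply/permP => i; apply/val_inj; rewrite /= (val_card s) (val_card t).
by congr #|pred_of_set _|; apply/setP => k; rewrite !inE lt_st.
Qed.

Lemma avoid132_ltn s i j : s \in avoiders n pat132 -> (i < j)%N ->
  (s i < s j)%N = [forall k : 'I_n, (i <= k < j)%N ==> ~~ leftmax s k j].
Proof.
rewrite inE => av ij; apply/idP/forallP => [sij k|h].
  apply/implyP => /andP[ik kj]; apply/negP => /leftmaxP[_ /(_ j)].
  rewrite kj leqnn => /(_ isT) sjk.
  have [eik|nik] := eqVneq i k; first by move: sjk; rewrite -eik ltnNge ltnW.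
  (* A left maximum at k strictly between i and j would dominate s j > s i, forming 132. *)
  case/negP: av; apply/contains132P; exists i, k, j.
  by rewrite kj sij sjk ltn_neqAle nik ik.
have ii : (i <= i <= j)%N by rewrite leqnn ltnW.
(* The position of the maximum of [s] on {i, ..., j} must be j itself: any other one would be a
   [leftmax] excluded by [h]. *)
case: (@arg_maxnP _ i (fun k : 'I_n => (i <= k <= j)%N) (fun k => s k) ii) => k /andP[ik kj] kmax.
have [ekj|nkj] := eqVneq k j.
  by rewrite perm_ltn_leq ?ltn_neq //; move: (kmax _ ii); rewrite ekj.
have lkj : (k < j)%N by rewrite ltn_neqAle kj andbT.
move: (h k); rewrite ik lkj /= => /negP[]; apply/leftmaxP; split=> // l /andP[kl lj].
rewrite perm_ltn_leq; first by apply: kmax; rewrite (leq_trans ik (ltnW kl)).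
by rewrite eq_sym ltn_neq.
Qed.

Lemma leftmax_perm_inj : {in avoiders n pat132 &, injective leftmax_perm}.
Proof.
move=> s t hs ht est; apply: inv_set_inj; apply/setP => -[i j]; rewrite !inE /=.
case: (ltnP i j) => //= ij.
have lm k l : leftmax s k l = leftmax t k l.
  have := inv_set_leftmax s; rewrite est inv_set_leftmax => /setP/(_ (k, l)).
  by rewrite !inE.
rewrite !(@perm_ltnN _ _ i) ?ltn_neq // !avoid132_ltn //; congr (~~ _); apply: eq_forallb => k; by rewrite lm.
Qed.

End LeftMaxima.

(** * The permutation 2 3 ... n 1, witness of strictness *)

Definition cycle_perm n : 'S_n := perm (@ordS_inj n).

Lemma cycle_perm_avoids n : cycle_perm n \in avoiders n pat132.
Proof.
rewrite inE; apply/negP => /contains132P[i [j [k]]]; rewrite !permE /=.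
case=> /andP[ij jk]; have kn := ltn_ord k.
have jn : (j.+1 < n)%N by exact: leq_ltn_trans jk kn.
rewrite (modn_small jn) (@modn_small i.+1) ?(ltn_trans _ jn) //.
(* If [k] is the last position, its value is 0 and cannot exceed that of [i]; otherwise the three
   values increase. *)
have [e|ne] := eqVneq k.+1 n; first by rewrite e modnn.
rewrite modn_small; lia.
Qed.

Lemma inv_leftmax_cycle n : (3 <= n)%N ->
  (inv (leftmax_perm (cycle_perm n)) < inv (cycle_perm n))%N.
Proof.
case: n => [|[|[|n]]] // _; apply: proper_card; apply/properP.
split; first exact: inv_set_leftmax_sub.
(* The lost inversion pairs the first and last positions: the second position, distinct from the
   last as n >= 3, already exceeds the first. *)
exists (ord0, ord_max); first by rewrite inE /= !permE /= modnn modn_small.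
rewrite inv_set_leftmax inE; apply/negP => /leftmaxP[_ /(_ (@Ordinal n.+3 1 isT) isT)].
by rewrite !permE /= !modn_small.
Qed.

(** * Comparison of Mallows probabilities *)

Lemma mallowsP_bij (R : realFieldType) (q : R) n (f : 'S_n -> 'S_n) (A B : {set 'S_n}) :
  involutive f -> (forall s, inv (f s) = inv s) ->
  (forall s, (f s \in A) = (s \in B)) -> mallowsP q A = mallowsP q B.
Proof.
move=> fK inv_f fAB; rewrite /mallowsP (reindex_inj (inv_inj fK)) /=.
by apply: eq_big => // s _; rewrite /mallows inv_f.
Qed.

Lemma avoiders_invg m n (t : 'S_m) (s : 'S_n) :
  (s^-1%g \in avoiders n t) = (s \in avoiders n t^-1%g).
Proof.
rewrite !inE; congr (~~ _); by apply/idP/idP => /contains_inv; rewrite invgK.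
Qed.

Lemma avoiders_rev_compl m n (t : 'S_m) (s : 'S_n) :
  (rev_compl s \in avoiders n t) = (s \in avoiders n (rev_compl t)).
Proof.
by rewrite !inE; congr (~~ _); apply/idP/idP => /contains_rev_compl;
  rewrite rev_complK.
Qed.

Lemma mallowsP_132_lt_231 (R : realFieldType) (q : R) n :
  0 < q -> q < 1 -> (3 <= n)%N ->
  mallowsP q (avoiders n pat132) < mallowsP q (avoiders n pat231).
Proof.
move=> q0 q1 n3.
apply: (@lt_le_trans _ _ (\sum_(s in avoiders n pat132) mallows q (leftmax_perm s))).
  (* The term of the cycle is isolated to give strictness; the others compare weakly. *)
  rewrite /mallowsP (bigD1 (cycle_perm n)) ?cycle_perm_avoids //=.
  rewrite [ltRHS](bigD1 (cycle_perm n)) ?cycle_perm_avoids //=.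
  apply: ltr_leD.
    rewrite ltr_pM2r ?invr_gt0 ?mallows_Z_gt0 //.
    by rewrite ltr_iXn2l ?inv_leftmax_cycle.
  apply: ler_sum => s _; rewrite ler_pM2r ?invr_gt0 ?mallows_Z_gt0 //.
  by rewrite ler_wiXn2l ?ltW // subset_leq_card // inv_set_leftmax_sub.
(* By injectivity the middle sum is the mass of the image, a subset of the 231-avoiders. *)
rewrite -(big_imset (mallows q) leftmax_perm_inj) /= /mallowsP.
rewrite [leRHS](big_setID (leftmax_perm @: avoiders n pat132)) /= (setIidPr _).
  by rewrite lerDl sumr_ge0 // => s _; exact: mallows_ge0.
by apply/subsetP => _ /imsetP[s _ ->]; exact: leftmax_perm_avoids.
Qed.

Theorem proposition2 (R : realFieldType) (q : R) (hq0 : 0 < q) (hq1 : q < 1)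
    (n : nat) (hn : (3 <= n)%N) :
  mallowsP q (avoiders n pat312) = mallowsP q (avoiders n pat231) /\
  mallowsP q (avoiders n pat231) > mallowsP q (avoiders n pat213) /\
  mallowsP q (avoiders n pat213) = mallowsP q (avoiders n pat132).
Proof.
have e : mallowsP q (avoiders n pat213) = mallowsP q (avoiders n pat132).
  apply: (@mallowsP_bij R q n (@rev_compl n)) => [||s].
  - exact: rev_complK.
  - exact: inv_rev_compl.
  - by rewrite avoiders_rev_compl rev_compl_pat213.
split; last by rewrite e; split=> //; exact: mallowsP_132_lt_231.
apply: (@mallowsP_bij R q n invg) => [||s].
- exact: invgK.
- exact: inv_permV.
- by rewrite avoiders_invg invg_pat312.
Qed.
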